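(* For any group $\Gamma$ we have $\eta(\Gamma)=1-1/\mathrm{Lit}(\Gamma)$.
   Context: $T_1(\Gamma)$ is the space of all $f\colon\Gamma\to\mathbf{C}$ for which there exist $f_1,f_2\colon\Gamma\times\Gamma\to\mathbf{C}$ with $f(x^{-1}y)=f_1(x,y)+f_2(x,y)$ for all $x,y$, $\sup_x\sum_y|f_1(x,y)|<\infty$, $\sup_y\sum_x|f_2(x,y)|<\infty$; $\mathrm{Lit}(\Gamma)=\inf\{p>0:T_1(\Gamma)\subseteq\ell^p(\Gamma)\}\in[0,\infty]$ (with $1/0=\infty$, $1/\infty=0$). For a finite symmetric $S\subseteq\Gamma$, $\mathrm{Cay}(\Gamma,S)$ is the (possibly disconnected) graph with vertex set $\Gamma$ and an edge between $g$ and $gs$ for each $s\in S$. For finite $F\subseteq\Gamma$, $\partial_S F$ is the set of edges joining $F$ to $\Gamma\setminus F$. The Cheeger constant is $h(\Gamma,S)=\inf_F|\partial_SF|/|F|$ over non-empty finite $F$, and $e(\Gamma,S)=1-h(\Gamma,S)/|S|$. Define $\eta(\Gamma)=-\liminf_S \frac{\ln e(\Gamma,S)}{\ln|S|}$, where the liminf is over the directed set of finite symmetric subsets ordered by inclusion, $\liminf_S f(S)=\sup_S\inf_{S'\supseteq S}f(S')$; by convention $\eta(\Gamma)=-\infty$ if $\Gamma$ is finite. *)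

(* Defs.v *)
From HB Require Import structures.
From mathcomp Require Import all_boot all_order all_algebra.
From mathcomp Require Import all_classical all_reals all_analysis.
From mathcomp Require Import finmap.
From mathcomp.real_closed Require Import complex.

Set Implicit Arguments.
Unset Strict Implicit.
Unset Printing Implicit Defensive.

Import Order.TTheory GRing.Theory Num.Theory.
Local Open Scope classical_set_scope.
Local Open Scope ring_scope.

Record is_group (G : Type) (mul : G -> G -> G) (inv : G -> G) (one : G) : Prop :=
  IsGroup {
    grp_mulA : forall x y z, mul x (mul y z) = mul (mul x y) z;
    grp_mul1g : forall x, mul one x = x;
    grp_mulg1 : forall x, mul x one = x;
    grp_mulVg : forall x, mul (inv x) x = one;
    grp_mulgV : forall x, mul x (inv x) = one }.

Section Defs.
Variables (R : realType) (G : choiceType).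
Variables (mul : G -> G -> G) (inv : G -> G).

Definition fcard (T : choiceType) (A : set T) : R := (#|` fset_set A|)%fset%:R.

Definition T1 : set (G -> R[i]) :=
  [set f | exists f1 f2 : G -> G -> R[i],
     (forall x y, f (mul (inv x) y) = f1 x y + f2 x y) /\
     (ereal_sup (range (fun x => \esum_(y in [set: G]) (ComplexField.Normc.normc (f1 x y))%:E))
        < +oo)%E /\
     (ereal_sup (range (fun y => \esum_(x in [set: G]) (ComplexField.Normc.normc (f2 x y))%:E))
        < +oo)%E].

Definition lp (p : R) : set (G -> R[i]) :=
  [set f | (\esum_(x in [set: G]) (ComplexField.Normc.normc (f x) `^ p)%:E < +oo)%E].

(* Lit(Gamma) = inf { p > 0 | T_1 subset l^p } in [0, +oo] (inf of empty = +oo) *)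
Definition Lit_exp : \bar R :=
  ereal_inf [set p%:E | p in [set p : R | 0 < p /\ T1 `<=` lp p]].

Definition symmetric_set (S : set G) := forall s, S s -> S (inv s).

(* boundary edges of F in Cay(Gamma,S): pairs (g,s), g in F, s in S, gs notin F *)
Definition boundary (S F : set G) : set (G * G) :=
  [set p | F p.1 /\ S p.2 /\ ~ F (mul p.1 p.2)].

Definition cheeger (S : set G) : R :=
  inf [set fcard (boundary S F) / fcard F |
         F in [set F : set G | finite_set F /\ F !=set0]].

Definition e_const (S : set G) : R := 1 - cheeger S / fcard S.

Definition eta_ratio (S : set G) : R := ln (e_const S) / ln (fcard S).

Definition fin_sym := [set S : set G | finite_set S /\ symmetric_set S].

(* eta(Gamma) = - liminf_S ln e / ln |S|, liminf over the directed set of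
   finite symmetric subsets ordered by inclusion; -oo if Gamma finite *)
Definition eta_exp : \bar R :=
  if `[< finite_set [set: G] >] then -oo%E
  else (- ereal_sup [set ereal_inf [set (eta_ratio S')%:E |
                                     S' in [set S' | fin_sym S' /\ S `<=` S']]
                    | S in fin_sym])%E.

End Defs.

Definition einv (R : realType) (x : \bar R) : \bar R :=
  match x with
  | EFin r => if r == 0 then +oo%E else (r^-1)%:E
  | _ => 0%E
  end.

(* Main.v *)
(** For finite symmetric [S], let [d(S) = |S| - h(S) = e(S) |S|] be the supremum
    of the average degrees of finite subgraphs of the Cayley graph, so that
    [1 <= d(S) <= |S|] and [eta] measures the growth of [d(S)] against [|S|].

    By Rado's form of Hall's theorem the pairs [(x, y)] with [x^-1 y] in [S] can
    be distributed between rows and columns with at most [d(S) + 1] of them in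
    each, so the indicator of [S] has norm at most [2 d(S)] in [T_1]. If [T_1] is
    contained in [l^p], a gliding hump (an explicit closed graph argument) gives
    [|S| <= K d(S)^p], hence [eta <= 1 - 1/p].

    Conversely, if [|S| <= d(S)^p] for all large [S] and [f] is in [T_1], summing
    [|f (x^-1 y)|] over [F * F] bounds [d] of a superlevel set
    [{|f| >= t}] by [C / t]; so [f] is in weak [l^p], and in [l^q] for
    all [q > p]. *)
From Pilot Require Import Defs.
From HB Require Import structures.
From mathcomp Require Import all_boot all_order all_algebra.
From mathcomp Require Import all_classical all_reals all_analysis.
From mathcomp Require Import finmap.
From mathcomp.real_closed Require Import complex.
From mathcomp Require Import zify ring lra.
(* [fcard] would otherwise denote the notation of fingraph. *)
Import Pilot.Defs.

Set Implicit Arguments.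
Unset Strict Implicit.
Unset Printing Implicit Defensive.

Import Order.TTheory GRing.Theory Num.Theory.
Local Open Scope classical_set_scope.
Local Open Scope ring_scope.

(** * Orienting sparse graphs: Rado's form of Hall's theorem *)

Section Orientation.
Variables (E V : choiceType) (u v : E -> V).

Let endpoint (p : E * bool) := if p.2 then u p.1 else v p.1.

Local Open Scope fset_scope.

(** [R] records discarded options: [(e, true)] in [R] forbids assigning [e] to [u e], and
    [(e, false)] forbids [v e]. What remains are the vertices still available to the edges of
    [I]. *)
Let ends (R : set (E * bool)) (I : {fset E}) : {fset V} :=
  [fset u e | e in [fset e in I | ~~ `[<R (e, true)>]]] `|`
  [fset v e | e in [fset e in I | ~~ `[<R (e, false)>]]].

Let endsP R I w :
  reflect (exists p, [/\ p.1 \in I, ~ R p & w = endpoint p]) (w \in ends R I).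
Proof.
rewrite in_fsetU; apply: (iffP orP) => [[]/imfsetP[e /=]|[[e b]] /=].
- by rewrite !inE /= => /andP[eI /asboolPn nR] ->; exists (e, true).
- by rewrite !inE /= => /andP[eI /asboolPn nR] ->; exists (e, false).
move=> [eI nR ->]; case: b nR => nR; [left|right]; apply/imfsetP;
  by exists e => //=; rewrite !inE eI; apply/asboolPn.
Qed.

Let hall (D : nat) (E0 : set E) (R : set (E * bool)) := forall I : {fset E},
  (forall e, e \in I -> E0 e) -> (#|` I| <= D * #|` ends R I|)%N.

(** Hall's condition tests one finite [I] at a time, and [I] has finitely many options; those lying
    in the union of the chain already lie in a single member [B]. *)
Let hall_bigcup D E0 (F : set (set (E * bool))) :
  hall D E0 set0 -> total_on F subset -> (F `<=` hall D E0)%classic ->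
  hall D E0 (\bigcup_(X in F) X).
Proof.
move=> H0 Ftot FH.
have [->|/set0P[B0 FB0]] := eqVneq F set0; first by rewrite bigcup_set0.
move=> I IE.
have [B FB BP] : exists2 B, F B & forall p, p.1 \in I ->
    (\bigcup_(X in F) X)%classic p -> B p.
  have [B FB BP] : exists2 B, F B & forall p,
      p \in [seq (e, b) | e <- I, b <- [:: true; false]] ->
      (\bigcup_(X in F) X)%classic p -> B p.
    elim: [seq _ | _ <- _, _ <- _] => [|q s [B FB BP]]; first by exists B0.
    have [[C FC Cq]|nq] := pselect ((\bigcup_(X in F) X)%classic q); last first.
      exists B => // p; rewrite inE => /predU1P[->|]; [by []|exact: BP].
    have [BC|CB] := Ftot _ _ FB FC.
      exists C => // p; rewrite inE => /predU1P[->//|ps Up].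
      exact/BC/(BP p).
    exists B => // p; rewrite inE => /predU1P[-> _|]; [exact: CB|exact: BP].
  exists B => // -[e b] /= eI; apply: BP; apply/allpairsP; exists (e, b).
  by split=> //; case: b.
apply: leq_trans (FH _ FB _ IE) _; rewrite leq_mul2l fsubset_leq_card ?orbT//.
apply/fsubsetP => w /endsP[p [pI nB ->]]; apply/endsP; exists p; split=> //.
by apply: contra_not nB; exact: BP.
Qed.

(* Rado's step: if neither option of [e] can be discarded, the two violating
   sets [I] and [J] contradict the Hall condition for [I `|` J `|` {e}] and
   [I `&` J], by submodularity of the number of endpoints. *)
Let hall_discard D E0 R e : E0 e -> hall D E0 R ->
  ~ R (e, true) -> ~ R (e, false) ->
  exists b, hall D E0 ((e, b) |` R)%classic.
Proof.
move=> E0e HR nRt nRf; apply: contrapT => /forallNP nH.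
have viol b : exists I : {fset E}, [/\ forall x, x \in I -> E0 x, e \notin I &
    (D * #|` endpoint (e, ~~ b) |` ends R I| <= #|` I|)%N].
  have /existsNP[I /not_implyP[IE /negP]] := nH b.
  rewrite -ltnNge => HI.
  (* Discarding an option of [e] changes nothing for sets avoiding [e], so a violating set contains
     [e]. Removing [e] from it then turns the strict inequality into a weak one. *)
  have eI : e \in I.
    apply: contraLR HI => eI; rewrite -leqNgt.
    have -> : ends ((e, b) |` R)%classic I = ends R I.
      apply/fsetP => w; apply/endsP/endsP => -[p [pI nR ->]];
        exists p; split=> //; first by apply: contra_not nR; right.
      by move=> [pe|//]; move: eI; rewrite pe /= in pI; rewrite pI.
    exact: HR.
  exists (I `\ e); split; [|by rewrite !inE eqxx|].
    by move=> x; rewrite !inE => /andP[_]; exact: IE.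
  move: HI; rewrite (cardfsD1 e I) eI add1n ltnS; apply: leq_trans.
  rewrite leq_mul2l fsubset_leq_card ?orbT//.
  apply/fsubsetP => w; rewrite in_fset1U => /predU1P[->|/endsP[p [pI nR ->]]];
      apply/endsP.
    exists (e, ~~ b); split=> //.
    by move=> [[]|]; case: (b).
  exists p; split=> //; first by move: pI; rewrite !inE => /andP[].
  move=> [pe|//]; by move: pI; rewrite pe !inE eqxx.
have [I [IE eI HI]] := viol true; have [J [JE eJ HJ]] := viol false.
rewrite /= in HI HJ.
set P := _ |` _ in HI; set Q := _ |` _ in HJ.
(* [P] contains [v e] and [Q] contains [u e], so [e] can be added to the union without creating a
   new end. This gains the extra one that contradicts [HI] and [HJ]. *)
have HU : (#|` I `|` J|.+1 <= D * #|` P `|` Q|)%N.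
  have -> : #|` I `|` J|.+1 = #|` e |` (I `|` J)|.
    by rewrite cardfsU1 in_fsetU (negPf eI) (negPf eJ).
  apply: leq_trans (HR _ _) _.
    by move=> x; rewrite !inE => /or3P[/eqP->//|/IE//|/JE].
  rewrite leq_mul2l fsubset_leq_card ?orbT//.
  apply/fsubsetP => w /endsP[[x b] [/=]].
  rewrite in_fset1U in_fsetU => xIJ nR ->; rewrite /P /Q in_fsetU !in_fset1U.
  case/or3P: xIJ nR => [/eqP->|xI|xJ] nR.
  - by case: b {nR}; rewrite /endpoint eqxx ?orbT.
  - apply/orP; left; apply/orP; right; apply/endsP; exists (x, b); by split.
  - apply/orP; right; apply/orP; right; apply/endsP; exists (x, b); by split.
have HN : (#|` I `&` J| <= D * #|` P `&` Q|)%N.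
  apply: leq_trans (HR _ _) _; first by move=> x; rewrite !inE => /andP[/IE].
  rewrite leq_mul2l fsubset_leq_card ?orbT//.
  apply/fsubsetP => w /endsP[p []]; rewrite in_fsetI => /andP[pI pJ] nR ->.
  rewrite /P /Q in_fsetI !in_fset1U.
  by apply/andP; split; apply/orP; right; apply/endsP; exists p.
have := cardfsUI I J; have := cardfsUI P Q; nia.
Qed.

(** By Zorn's lemma, take a maximal set of discarded options that keeps Hall's condition. Every edge
    of [E0] has then lost an option, so edges assigned to [w] have no end left but [w], and Hall's
    condition bounds their number by [D]. *)
Lemma orientation_of_sparse (D : nat) (E0 : set E) :
  (forall I : {fset E}, (forall e, e \in I -> E0 e) ->
    (#|` I| <= D * #|` [fset u e | e in I] `|` [fset v e | e in I]|)%N) ->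
  exists o : E -> bool, forall (w : V) (I : {fset E}),
    (forall e, e \in I -> E0 e /\ (if o e then u e else v e) = w) ->
    (#|` I| <= D)%N.
Proof.
move=> HE.
have H0 : hall D E0 set0.
  move=> I IE; apply: leq_trans (HE I IE) _.
  rewrite leq_mul2l fsubset_leq_card ?orbT//.
  apply/fsubsetP => w; rewrite in_fsetU => /orP[]/imfsetP[e /= eI ->];
    apply/endsP;
    by [exists (e, true); split|exists (e, false); split].
have [R [HR Rmax]] := Zorn_bigcup (fun F sF tF => hall_bigcup H0 tF sF).
have Rtf e : E0 e -> R (e, true) \/ R (e, false).
  move=> E0e; apply: contrapT => /not_orP[nt nf].
  have [b Hb] := hall_discard E0e HR nt nf.
  apply: (Rmax _ _ Hb); split; first by right.
  by move=> /(_ (e, b) (or_introl erefl)); case: b {Hb}.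
exists (fun e => `[<~ R (e, true)>]) => w I Iw.
apply: leq_trans (HR I _) _; first by move=> e /Iw[].
rewrite -[leqRHS]muln1 leq_mul2l -(cardfs1 w) fsubset_leq_card ?orbT//.
apply/fsubsetP => x /endsP[[e b] [/= /Iw[E0e we] nR ->]].
rewrite inE -we /endpoint /=; apply/eqP.
case: asboolP => [nRt|/contrapT Ret]; case: b nR => nR //.
by have [] := Rtf _ E0e.
Qed.

End Orientation.

(** * Cardinalities as sums of indicators *)

Section CardSum.
Variable R : realType.

Lemma sum_indicator (T : choiceType) (X : {fset T}) (P : pred T) :
  \sum_(x <- X) (P x)%:R = (#|` [fset x in X | P x]%fset|)%:R :> R.
Proof.
rewrite card_fset_sum1 natr_sum -big_fset_condE [RHS]big_mkcond /=.
by apply: eq_bigr => x _; case: (P x).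
Qed.

Lemma fcard_sum (T : choiceType) (A : set T) (X : {fset T}) :
  A `<=` [set` X] -> fcard R A = \sum_(x <- X) (`[<A x>])%:R.
Proof.
move=> AX; have Afin : finite_set A by exact: sub_finite_set AX _.
rewrite sum_indicator /fcard; congr (#|` _|)%:R; apply/fsetP => x.
rewrite in_fset_set// !inE/=; apply/idP/andP => [/set_mem Ax|[_ /asboolP]].
  by split; [exact: AX|exact/asboolP].
exact: mem_set.
Qed.

Lemma big_fsetM (T U : choiceType) (A : {fset T}) (B : {fset U})
    (f : T * U -> R) :
  \sum_(p <- (A `*` B)%fset) f p = \sum_(x <- A) \sum_(y <- B) f (x, y).
Proof. by rewrite /fsetM big_imfset2//= => -[? ?] [? ?] _ _ [-> ->]. Qed.

Lemma sumr_const_fset (T : choiceType) (A : {fset T}) (c : R) :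
  \sum_(x <- A) c = (#|` A|)%:R * c.
Proof. by rewrite big_const_seq count_predT iter_addr_0 mulr_natl. Qed.

Lemma fcard_fset (T : choiceType) (A : {fset T}) :
  fcard R [set` A] = (#|` A|)%:R.
Proof. by rewrite /fcard set_fsetK. Qed.

Lemma fcard_ge0 (T : choiceType) (A : set T) : 0 <= fcard R A.
Proof. exact: ler0n. Qed.

Lemma fcard_ge1 (T : choiceType) (A : set T) :
  finite_set A -> A !=set0 -> 1 <= fcard R A.
Proof.
move=> Afin [x Ax]; rewrite /fcard ler1n cardfs_gt0; apply/fset0Pn; exists x.
by rewrite in_fset_set// in_setE.
Qed.

Lemma fcard_gt0_nonempty (T : choiceType) (A : set T) :
  0 < fcard R A -> A !=set0.
Proof.
move=> A_gt0; apply/set0P/eqP => A0.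
by move: A_gt0; rewrite A0 /fcard fset_set0 cardfs0 ltxx.
Qed.

Lemma le_fcard (T : choiceType) (A B : set T) :
  finite_set B -> A `<=` B -> fcard R A <= fcard R B.
Proof.
move=> Bfin AB; rewrite ler_nat; apply: fsubset_leq_card.
by rewrite -fset_set_sub//; exact: sub_finite_set AB Bfin.
Qed.

End CardSum.

(** * The Cheeger constant and the maximal average degree *)

Section Cheeger.
Variables (R : realType) (G : choiceType).
Variables (mul : G -> G -> G) (inv : G -> G) (one : G).
Hypothesis HG : is_group mul inv one.

Let mulKg x y : mul (inv x) (mul x y) = y.
Proof. by rewrite (grp_mulA HG) (grp_mulVg HG) (grp_mul1g HG). Qed.

Let mulVKg x y : mul x (mul (inv x) y) = y.
Proof. by rewrite (grp_mulA HG) (grp_mulgV HG) (grp_mul1g HG). Qed.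

Let mulgI x : injective (mul x).
Proof. by move=> y z /(congr1 (mul (inv x))); rewrite !mulKg. Qed.

Lemma grp_invK : involutive inv.
Proof. by move=> x; rewrite -[LHS](grp_mulg1 HG) -(grp_mulVg HG x) mulKg. Qed.

Lemma grp_invM x y : inv (mul x y) = mul (inv y) (inv x).
Proof.
apply: (@mulgI (mul x y)).
by rewrite (grp_mulgV HG) -(grp_mulA HG) mulVKg (grp_mulgV HG).
Qed.

Lemma grp_inv1 : inv one = one.
Proof. by rewrite -[LHS](grp_mulg1 HG) (grp_mulVg HG). Qed.

Implicit Types (S : set G) (F : {fset G}).

Definition inner_pairs S F : R :=
  \sum_(x <- F) \sum_(y <- F) (`[<S (mul (inv x) y)>])%:R.

(* The supremum over [F] of the average number of neighbours inside [F]. *)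
Definition max_avg_degree S : R := fcard R S - cheeger R mul S.

Lemma sum_translate S F x : finite_set S ->
  \sum_(y <- F) (`[<S (mul (inv x) y)>])%:R =
  \sum_(s <- fset_set S) (mul x s \in F)%:R :> R.
Proof.
move=> Sfin; pose A := [set y | y \in F /\ S (mul (inv x) y)].
transitivity (fcard R A).
  rewrite (@fcard_sum _ _ _ F)//; last by move=> y [].
  apply: eq_big_seq => y yF; congr (nat_of_bool _)%:R.
  by apply/asboolP/asboolP => [|[]].
rewrite (@fcard_sum _ _ _ [fset mul x s | s in fset_set S]%fset); last first.
  move=> y [_ Sy]; apply/imfsetP; exists (mul (inv x) y) => /=.
    by rewrite in_fset_set// in_setE.
  by rewrite mulVKg.
rewrite big_imfset /=; last by move=> ? ? _ _; exact: mulgI.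
apply: eq_big_seq => s; rewrite in_fset_set// in_setE => Ss.
congr (nat_of_bool _)%:R; apply/asboolP/idP => [[]//|sF].
by split=> //; rewrite mulKg.
Qed.

(** For [x] in [F] and [s] in [S], the product [mul x s] is either outside [F], a boundary edge, or
    inside, an inner pair. *)
Lemma inner_pairs_boundary S F : finite_set S ->
  fcard R (boundary mul S [set` F]) + inner_pairs S F = (#|` F|)%:R * fcard R S.
Proof.
move=> Sfin; rewrite (@fcard_sum _ _ _ (F `*` fset_set S)%fset); last first.
  by move=> [x s] [/= xF [Ss _]]; rewrite inE /= xF in_fset_set ?in_setE.
rewrite big_fsetM -big_split /= -sumr_const_fset; apply: eq_big_seq => x xF.
rewrite sum_translate// -big_split /= /fcard -[RHS]mulr1 -sumr_const_fset.
apply: eq_big_seq => s; rewrite in_fset_set// in_setE => Ss.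
case: asboolP => [[_ [_ /= /negP/negPf ->]]|]; first by rewrite addr0.
rewrite /boundary /=; case: (boolP (mul x s \in F)) => [_ _|/negP xs []//].
by rewrite add0r.
Qed.

Lemma cheeger_lbound S :
  lbound [set fcard R (boundary mul S F) / fcard R F |
          F in [set F : set G | finite_set F /\ F !=set0]] 0.
Proof. by move=> _ [F _ <-]; rewrite divr_ge0 ?fcard_ge0. Qed.

Lemma cheeger_ge0 S : 0 <= cheeger R mul S.
Proof.
apply: lb_le_inf; last exact: cheeger_lbound.
exists (fcard R (boundary mul S [set one]) / fcard R [set one]), [set one] => //.
by split=> //; exists one.
Qed.

Lemma max_avg_degree_le_card S : max_avg_degree S <= fcard R S.
Proof. by rewrite lerBlDr lerDl cheeger_ge0. Qed.

Lemma inner_pairs_le S F : finite_set S ->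
  inner_pairs S F <= max_avg_degree S * (#|` F|)%:R.
Proof.
move=> Sfin; have [->|F0] := eqVneq F fset0.
  by rewrite /inner_pairs big_seq_fset0 cardfs0 mulr0.
have F_gt0 : 0 < (#|` F|)%:R :> R by rewrite ltr0n cardfs_gt0.
rewrite mulrBl lerBrDr [leRHS]mulrC -(inner_pairs_boundary F Sfin).
rewrite addrC lerD2r -ler_pdivlMr// -fcard_fset.
apply: ge_inf; first by exists 0; exact: cheeger_lbound.
exists [set` F] => //; split=> //.
by have /fset0Pn[x xF] := F0; exists x.
Qed.

(** Together with [inner_pairs_le], this characterizes [max_avg_degree] as a supremum, so that the
    Cheeger constant itself can be forgotten. *)
Lemma max_avg_degree_le S (c : R) : finite_set S ->
  (forall F, inner_pairs S F <= c * (#|` F|)%:R) -> max_avg_degree S <= c.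
Proof.
move=> Sfin Hc; rewrite lerBlDr -lerBlDl; apply: lb_le_inf.
  exists (fcard R (boundary mul S [set one]) / fcard R [set one]), [set one] => //.
  by split=> //; exists one.
move=> _ [A [Afin [x Ax]] <-].
have A_gt0 : 0 < fcard R A.
  by apply: lt_le_trans ltr01 _; apply: fcard_ge1 => //; exists x.
rewrite ler_pdivlMr// mulrBl lerBlDr -(fset_setK Afin) fcard_fset mulrC.
by rewrite -inner_pairs_boundary// lerD2l; exact: Hc.
Qed.

(** Test on [F = {one, s}]: by symmetry both [(one, s)] and [(s, one)] are inner pairs. If
    [s = one], the single vertex carries a loop. *)
Lemma max_avg_degree_ge1 S : finite_set S -> symmetric_set inv S -> S !=set0 ->
  1 <= max_avg_degree S.
Proof.
move=> Sfin Ssym [s Ss]; have := inner_pairs_le [fset one; s]%fset Sfin.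
have F_gt0 : 0 < (#|` [fset one; s]%fset|)%:R :> R by rewrite cardfs2.
rewrite -ler_pdivrMr//; apply: le_trans; rewrite ler_pdivlMr// mul1r.
have ind1 x : S x -> (`[<S x>])%:R = 1 :> R by move=> /asboolT ->.
have [s1|s1] := eqVneq s one.
  rewrite s1 fsetUid cardfs1 /inner_pairs !big_seq_fset1 (grp_mulVg HG) ind1//.
  by rewrite -s1.
have sum2 (f : G -> R) : \sum_(x <- [fset one; s]%fset) f x = f one + f s.
  by rewrite big_fsetU1 ?in_fset1 1?eq_sym//= big_seq_fset1.
rewrite cardfs2 eq_sym s1 /inner_pairs !sum2.
rewrite grp_inv1 !(grp_mul1g HG) !(grp_mulg1 HG).
rewrite [in leRHS](ind1 s)// (ind1 (inv s)); last exact: Ssym.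
set a := (`[<S one>])%:R; set b := (`[<S (mul _ s)>])%:R.
have a0 : 0 <= a by exact: ler0n.
have b0 : 0 <= b by exact: ler0n.
by rewrite -[leLHS]/(2%:R : R); lra.
Qed.

(** View [(x, y)] as an edge with ends [x] and [y]. If [F] is the set of all coordinates of a finite
    set [I] of such pairs, then [I] lies in [F * F], so it has at most [inner_pairs], hence at most
    [D] times [#|F|], elements. *)
Lemma sparse_orientation S (D : nat) : finite_set S ->
  max_avg_degree S <= D%:R ->
  exists o : G -> G -> bool,
    (forall x (Y : {fset G}),
      (forall y, y \in Y -> S (mul (inv x) y) /\ o x y) -> (#|` Y| <= D)%N) /\
    (forall y (X : {fset G}),
      (forall x, x \in X -> S (mul (inv x) y) /\ ~~ o x y) -> (#|` X| <= D)%N).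
Proof.
move=> Sfin SD.
have [I IS|o Ho] := @orientation_of_sparse _ _ fst snd D
    [set p | S (mul (inv p.1) p.2)].
  set F := (_ `|` _)%fset; rewrite -(ler_nat R) natrM.
  apply: le_trans (ler_wpM2r (ler0n _ _) SD); apply: le_trans (inner_pairs_le F Sfin).
  rewrite -fcard_fset (@fcard_sum _ _ _ (F `*` F)%fset); last first.
    move=> p pI; rewrite /= in_fsetM; apply/andP.
    by split; rewrite in_fsetU; apply/orP; [left|right]; apply/imfsetP; exists p.
  rewrite big_fsetM; do 2![apply: ler_sum => ? _]; rewrite ler_nat.
  by case: asboolP => // /IS /= Sxy; rewrite asboolT.
exists (fun x y => o (x, y)); split=> [x Y HY|y X HX].
  have -> : #|` Y| = #|` [fset (x, y) | y in Y]%fset|.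
    by rewrite card_imfset// => ? ? [].
  apply: (Ho x) => _ /imfsetP[y /= /HY[Sxy oxy] ->]; rewrite oxy; split=> //.
have -> : #|` X| = #|` [fset (x, y) | x in X]%fset|.
  by rewrite card_imfset// => ? ? [].
by apply: (Ho y) => _ /imfsetP[x /= /HX[Sxy /negPf oxy] ->]; rewrite oxy.
Qed.

End Cheeger.

(** * From an inclusion of [T1] in [lp] to a cardinality bound: the gliding hump *)

Section GlidingHump.
Variables (R : realType) (G : choiceType).
Variables (mul : G -> G -> G) (inv : G -> G) (one : G).
Hypothesis HG : is_group mul inv one.

Lemma powRV (x r : R) : 0 < x -> x^-1 `^ r = (x `^ r)^-1.
Proof.
by move=> x0; rewrite -(powR_inv1 (ltW x0)) powRAC (powR_inv1 (powR_ge0 x r)).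
Qed.

Lemma geometric_sum_le (r : R) n : 0 <= r -> r < 1 ->
  \sum_(i < n) r ^+ i <= (1 - r)^-1.
Proof.
move=> r0 r1; rewrite -[leRHS]mulr1 ler_pdivlMl ?subr_gt0//.
by rewrite -opprB mulNr -subrX1 opprB gerBl exprn_ge0.
Qed.

Lemma normc_real (r : R) : 0 <= r -> ComplexField.Normc.normc r%:C%C = r.
Proof. by move=> r0; rewrite /= expr0n addr0 sqrtr_sqr ger0_norm. Qed.

Lemma nneseries_half : (\sum_(n <oo) ((2^-1) ^+ n)%:E <= (2%:R : R)%:E)%E.
Proof.
have h0 n : (0 <= ((2^-1 : R) ^+ n)%:E)%E by rewrite lee_fin exprn_ge0.
apply: lime_le; first by apply: is_cvg_nneseries => n _ _; exact: h0.
apply: nearW => n; rewrite sumEFin lee_fin big_mkord.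
apply: le_trans (geometric_sum_le n _ _) _.
- by rewrite invr_ge0.
- by rewrite invf_lt1// ltr1n.
- by rewrite (_ : 1 - 2^-1 = 2^-1) ?invrK//; lra.
Qed.

(** Faithful only for convergent series, since [fine] sends an infinite sum to 0; convergence is
    what [sum_seriesK] supplies. *)
Definition sum_series (h : nat -> R) : R := fine (\sum_(n <oo) (h n)%:E)%E.

Section Summation.
Variables (T : choiceType) (h : T -> nat -> R).
Hypothesis h_ge0 : forall t n, 0 <= h t n.
Hypothesis h_sum : forall n (Y : {fset T}), \sum_(t <- Y) h t n <= (2^-1) ^+ n.

Let h_ge0E t n : (0 <= (h t n)%:E)%E. Proof. by rewrite lee_fin. Qed.

Let sum_h_le (Y : {fset T}) :
  (\sum_(t <- Y) \sum_(n <oo) (h t n)%:E <= (2%:R : R)%:E)%E.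
Proof.
rewrite -nneseries_sum//; apply: le_trans nneseries_half.
by apply: lee_nneseries => n _; rewrite ?sume_ge0// sumEFin lee_fin.
Qed.

Lemma sum_seriesK t : (sum_series (h t))%:E = (\sum_(n <oo) (h t n)%:E)%E.
Proof.
rewrite fineK// ge0_fin_numE ?nneseries_ge0//.
by have := sum_h_le [fset t]%fset; rewrite big_seq_fset1 => /le_lt_trans->; rewrite ?ltry.
Qed.

Lemma sum_series_ge0 t : 0 <= sum_series (h t).
Proof. by rewrite -lee_fin sum_seriesK nneseries_ge0. Qed.

Lemma sum_series_ge t n : h t n <= sum_series (h t).
Proof.
rewrite -lee_fin sum_seriesK; apply: le_trans (nneseries_lim_ge n.+1 _) => //.
by rewrite big_nat_recr//= leeDr// sume_ge0.
Qed.

Lemma esum_sum_series_le :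
  (\esum_(t in [set: T]) (ComplexField.Normc.normc (sum_series (h t))%:C%C)%:E
     <= (2%:R : R)%:E)%E.
Proof.
apply: ge_ereal_sup => _ [A [Afin _] <-]; rewrite fsbig_finite//.
apply: le_trans (sum_h_le (fset_set A)); apply: lee_sum => t _.
by rewrite -sum_seriesK normc_real// sum_series_ge0.
Qed.

End Summation.

(** Take [f] to be the sum of [a n] times the indicator of [S n], and split each term along [o n].
    The [n]-th piece adds at most [(2^-1) ^+ n] to every row of [f1] and every column of [f2], so
    all these sums are at most 2. *)
Lemma hump_T1 (a : nat -> R) (S : nat -> set G) (o : nat -> G -> G -> bool) :
  (forall n, 0 <= a n) ->
  (forall n x (Y : {fset G}),
    (forall y, y \in Y -> S n (mul (inv x) y) /\ o n x y) ->
    a n * (#|` Y|)%:R <= (2^-1) ^+ n) ->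
  (forall n y (X : {fset G}),
    (forall x, x \in X -> S n (mul (inv x) y) /\ ~~ o n x y) ->
    a n * (#|` X|)%:R <= (2^-1) ^+ n) ->
  exists2 f : G -> R[i], T1 mul inv f &
    forall n x, S n x -> a n <= ComplexField.Normc.normc (f x).
Proof.
move=> a0 Hrow Hcol.
pose h1 x y n := a n * (`[<S n (mul (inv x) y)>] && o n x y)%:R.
pose h2 x y n := a n * (`[<S n (mul (inv x) y)>] && ~~ o n x y)%:R.
have h1_ge0 x y n : 0 <= h1 x y n by rewrite mulr_ge0.
have h2_ge0 x y n : 0 <= h2 x y n by rewrite mulr_ge0.
have h1_sum x n (Y : {fset G}) : \sum_(y <- Y) h1 x y n <= (2^-1) ^+ n.
  rewrite -mulr_sumr sum_indicator; apply: (Hrow n x) => y.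
  by rewrite !inE /= => /andP[_ /andP[/asboolP]].
have h2_sum y n (X : {fset G}) : \sum_(x <- X) h2 x y n <= (2^-1) ^+ n.
  rewrite -mulr_sumr sum_indicator; apply: (Hcol n y) => x.
  by rewrite !inE /= => /andP[_ /andP[/asboolP]].
pose h x n := a n * (`[<S n x>])%:R.
pose f x := (sum_series (h x))%:C%C.
have hE x y n : (h (mul (inv x) y) n)%:E = ((h1 x y n)%:E + (h2 x y n)%:E)%E.
  rewrite -EFinD; congr EFin; rewrite /h /h1 /h2 -mulrDr -natrD; congr (_ * _%:R).
  by case: asboolP => // _; case: (o n x y).
have h_ge0 x n : 0 <= h x n by rewrite mulr_ge0.
have hS x y : (sum_series (h (mul (inv x) y)))%:E =
    ((sum_series (h1 x y))%:E + (sum_series (h2 x y))%:E)%E.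
  rewrite (sum_seriesK (h1_ge0 x) (h1_sum x)).
  rewrite (sum_seriesK (fun x => h2_ge0 x y) (h2_sum y)).
  rewrite -nneseriesD; [|by move=> n _ _; rewrite lee_fin..].
  rewrite -(eq_eseriesr (fun n _ => hE x y n)) fineK//.
  rewrite ge0_fin_numE ?nneseries_ge0// => [|n _ _]; last by rewrite lee_fin.
  under eq_eseriesr do rewrite hE.
  rewrite nneseriesD; [|by move=> n _ _; rewrite lee_fin..].
  rewrite -(sum_seriesK (h1_ge0 x) (h1_sum x)).
  by rewrite -(sum_seriesK (fun x => h2_ge0 x y) (h2_sum y)) ltry.
(* Convergence at [x] comes from the splitting at the pair [(one, x)]. *)
have h_ge x n : h x n <= sum_series (h x).
  have := hE one x n; have := hS one x.
  rewrite (grp_inv1 HG) (grp_mul1g HG) -!EFinD => -[->] [->]; apply: lerD.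
    exact: (sum_series_ge (h1_ge0 one) (h1_sum one)).
  exact: (sum_series_ge (fun t => h2_ge0 t x) (h2_sum x)).
exists f; last first.
  move=> n x Sx; rewrite normc_real; last exact: le_trans (h_ge0 x n) (h_ge x n).
  by apply: le_trans (h_ge x n); rewrite /h asboolT// mulr1.
exists (fun x y => (sum_series (h1 x y))%:C%C), (fun x y => (sum_series (h2 x y))%:C%C).
split=> [x y|]; first by rewrite -rmorphD; congr (_%:C)%C; apply: EFin_inj; exact: hS.
split; apply: (@le_lt_trans _ _ (2%:R : R)%:E); rewrite ?ltry//;
  apply: ge_ereal_sup => _ [x _ <-]; apply: esum_sum_series_le => //.
Qed.

Lemma T1_lp_card_bound (p : R) : 0 < p -> T1 mul inv `<=` @lp R G p ->
  exists2 K : R, 0 < K & forall S : set G,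
    finite_set S -> symmetric_set inv S -> S !=set0 ->
    fcard R S <= K * max_avg_degree R mul S `^ p.
Proof.
move=> p_gt0 T1p.
(* An integer capacity above the average degree; as that degree is at least 1, [D S] is at most
   twice it, whence the factor 2 in the constant below. *)
pose D S := (Num.truncn (max_avg_degree R mul S)).+1.
suff [k Hk] : exists k : nat, forall S : set G,
    finite_set S -> symmetric_set inv S -> S !=set0 ->
    fcard R S <= k.+1%:R * (2 ^+ k * (D S)%:R) `^ p.
  exists (k.+1%:R * (2 ^+ k * 2) `^ p).
    by rewrite mulr_gt0// powR_gt0// mulr_gt0// exprn_gt0.
  move=> S Sfin Ssym S0; have S1 := max_avg_degree_ge1 R HG Sfin Ssym S0.
  apply: le_trans (Hk S Sfin Ssym S0) _.
  rewrite -mulrA -powRM ?mulr_ge0 ?exprn_ge0//; last exact: le_trans S1.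
  rewrite ler_pM2l// ge0_ler_powR ?nnegrE ?mulr_ge0 ?exprn_ge0//; first exact: ltW.
    by rewrite (le_trans _ S1).
  rewrite -mulrA ler_pM2l ?exprn_gt0// /D -natr1.
  have /andP[h _] := truncn_itv (le_trans ler01 S1).
  lra.
apply: contrapT => /forallNP nH.
have /choice[S HS] : forall n, exists S : set G, [/\ finite_set S, symmetric_set inv S,
    S !=set0 & n.+1%:R * (2 ^+ n * (D S)%:R) `^ p < fcard R S].
  move=> n; have /existsNP[S /not_implyP[Sfin /not_implyP[Ssym]]] := nH n.
  move=> /not_implyP[S0 /negP].
  by rewrite -ltNge => ?; exists S.
have Sfin n : finite_set (S n) by have [] := HS n.
have /choice[ori Hori] := (fun n =>
  sparse_orientation HG (Sfin n) (ltW (truncnS_gt (max_avg_degree R mul (S n))))).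
pose a n : R := (2 ^+ n * (D (S n))%:R)^-1.
have c_gt0 n : 0 < 2 ^+ n * (D (S n))%:R :> R by rewrite mulr_gt0// exprn_gt0.
have aD n (m : nat) : (m <= D (S n))%N -> a n * m%:R <= (2^-1) ^+ n.
  move=> mD; rewrite /a invfM -mulrA exprVn ler_piMr ?invr_ge0 ?exprn_ge0//.
  by rewrite mulrC ler_pdivrMr// mul1r ler_nat.
have [f fT1 fge] : exists2 f : G -> R[i], T1 mul inv f &
    forall n x, S n x -> a n <= ComplexField.Normc.normc (f x).
  apply: (@hump_T1 a S ori) => [n|n x Y HY|n y X HX].
  - by rewrite invr_ge0 ltW.
  - by apply/aD/((Hori n).1 x).
  - by apply/aD/((Hori n).2 y).
have := T1p f fT1; rewrite /lp /=; set s := esum _ _ => s_fin.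
have s_ge n : (n.+1%:R%:E <= s)%E.
  have [_ _ _ Sn] := HS n.
  apply: esum_ge; exists (S n) => //; rewrite fsbig_finite//.
  apply: (@le_trans _ _ (\sum_(x <- fset_set (S n)) (a n `^ p)%:E)%E).
    rewrite sumEFin lee_fin sumr_const_fset /a.
    by rewrite powRV// ler_pdivlMr ?powR_gt0// ltW.
  rewrite big_seq [leRHS]big_seq; apply: lee_sum => x.
  rewrite in_fset_set// in_setE => Sx; rewrite lee_fin ge0_ler_powR ?nnegrE//.
  - exact: ltW.
  - by rewrite invr_ge0 ltW.
  - by apply: le_trans (fge n x Sx); rewrite invr_ge0 ltW.
  - exact: fge.
have := s_ge (Num.truncn (fine s)); rewrite -[s in X in X -> _]fineK; last first.
  rewrite ge0_fin_numE//; exact: le_trans (s_ge 0%N).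
rewrite lee_fin leNgt => /negP; apply; exact: truncnS_gt.
Qed.

End GlidingHump.

(** * From weak [l^p] to [l^q] for [q > p] *)

Section WeakType.
Variables (R : realType) (G : choiceType).
Implicit Types (X : {fset G}) (g : G -> R).

Lemma powR_exprn (x r : R) n : 0 <= x -> (x ^+ n) `^ r = (x `^ r) ^+ n.
Proof. by move=> x0; rewrite -powR_mulrn// powRAC powR_mulrn// powR_ge0. Qed.

Lemma ltr_powR2 (a x y : R) : 1 < a -> x < y -> a `^ x < a `^ y.
Proof.
move=> a1 xy; have a0 : 0 < a by exact: lt_trans a1.
by rewrite /powR gt_eqF// ltr_expR ltr_pM2r// ln_gt0.
Qed.

(** The slice where [g] lies between [K / 2 ^+ i.+1] and [K / 2 ^+ i] has at most [(2]^ p) ^+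
    i.+1[points, each contributing at most](K / 2 ^+ i) [^ q]. No value exceeds [K]: a single such
    point would already violate the weak bound. *)
Lemma dyadic_sum_bound (K p q : R) g : 0 < K -> 0 < p -> 0 < q ->
  (forall x, 0 <= g x) ->
  (forall X t, 0 < t -> (forall x, x \in X -> t <= g x) ->
    (#|` X|)%:R <= (K / t) `^ p) ->
  forall m X, (forall x, x \in X -> K / 2 ^+ m < g x) ->
  \sum_(x <- X) g x `^ q <=
    K `^ q * 2 `^ p * \sum_(i < m) (2 `^ p / 2 `^ q) ^+ i.
Proof.
move=> K0 p0 q0 g0 weak; elim=> [|m IH] X HX.
  rewrite big_ord0 mulr0; have -> : X = fset0; last by rewrite big_seq_fset0.
  apply/fsetP => x; rewrite inE; apply/negP => /HX; rewrite expr0 divr1 => Kg.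
  have gx0 : 0 < g x by exact: lt_trans Kg.
  have /(weak [fset x]%fset _ gx0) : forall y, y \in [fset x]%fset -> g x <= g y.
    by move=> y; rewrite inE => /eqP->.
  rewrite cardfs1 leNgt => /negP; apply.
  have -> : 1%:R = 1 `^ p :> R by rewrite powR1.
  rewrite gt0_ltr_powR ?nnegrE ?divr_ge0//; [exact: ltW|].
  by rewrite ltr_pdivrMr// mul1r.
have X2 : \sum_(x <- X | ~~ (K / 2 ^+ m < g x)) g x `^ q <=
    K `^ q * 2 `^ p * (2 `^ p / 2 `^ q) ^+ m.
  rewrite big_fset_condE; set Y := [fset _ in _ | _]%fset.
  apply: (@le_trans _ _ (\sum_(x <- Y) (K / 2 ^+ m) `^ q)).
    rewrite big_seq [leRHS]big_seq; apply: ler_sum => x.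
    rewrite !inE /= -leNgt => /andP[_ gx].
    by rewrite ge0_ler_powR ?nnegrE ?divr_ge0 ?exprn_ge0// ltW.
  rewrite sumr_const_fset.
  have /weak : 0 < K / 2 ^+ m.+1 by rewrite divr_gt0// exprn_gt0.
  move=> /(_ Y) HY.
  have {}HY : (#|` Y|)%:R <= (2 `^ p) ^+ m.+1.
    rewrite -powR_exprn//; apply: le_trans (HY _) _.
      by move=> x; rewrite !inE /= => /andP[xX _]; exact/ltW/HX.
    by rewrite invf_div mulrCA divff ?mulr1// gt_eqF.
  apply: le_trans (ler_wpM2r (powR_ge0 _ _) HY) _.
  rewrite powRM ?invr_ge0 ?exprn_ge0//; last exact: ltW.
  rewrite powRV ?exprn_gt0// powR_exprn// expr_div_n exprS.
  by rewrite le_eqVlt; apply/orP; left; apply/eqP; ring.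
rewrite big_ord_recr /= mulrDr (bigID (fun x => K / 2 ^+ m < g x)) /=.
apply: lerD X2; rewrite big_fset_condE; apply: IH => x.
by rewrite !inE /= => /andP[].
Qed.

Lemma weak_type_esum (K p q : R) g : 0 < K -> 0 < p -> p < q ->
  (forall x, 0 <= g x) ->
  (forall X t, 0 < t -> (forall x, x \in X -> t <= g x) ->
    (#|` X|)%:R <= (K / t) `^ p) ->
  (\esum_(x in [set: G]) (g x `^ q)%:E < +oo)%E.
Proof.
move=> K0 p0 pq g0 weak; have q0 : 0 < q by exact: lt_trans pq.
pose r : R := 2 `^ p / 2 `^ q.
have r0 : 0 <= r by rewrite divr_ge0 ?powR_ge0.
have r1 : r < 1.
  by rewrite ltr_pdivrMr ?powR_gt0// mul1r ltr_powR2// ltr1n.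
apply: (@le_lt_trans _ _ (K `^ q * 2 `^ p * (1 - r)^-1)%:E); last exact: ltry.
apply: ge_ereal_sup => _ [A [Afin _] <-].
rewrite fsbig_finite// sumEFin lee_fin; set X := fset_set A.
pose Y := [fset x in X | 0 < g x]%fset.
(* Large enough that [2 ^+ M] exceeds [K / g x] on all of [Y]; the final bound does not depend on
   [M]. *)
pose M := (\max_(x <- Y) (Num.truncn (K / g x)).+1)%N.
have -> : \sum_(x <- X) g x `^ q = \sum_(x <- Y) g x `^ q.
  rewrite -big_fset_condE [LHS](bigID (fun x => 0 < g x)) /= [X in _ + X]big1 ?addr0//.
  move=> x; rewrite -leNgt => gx; have -> : g x = 0 by apply/le_anti; rewrite gx g0.
  by rewrite powR0// gt_eqF.
apply: le_trans (@dyadic_sum_bound K p q g K0 p0 q0 g0 weak M Y _) _ => [x xY|].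
  have gx : 0 < g x by move: xY; rewrite !inE /= => /andP[].
  rewrite ltr_pdivrMr ?exprn_gt0// -ltr_pdivrMl//.
  rewrite mulrC; apply: lt_le_trans (truncnS_gt _) _.
  rewrite -natrX ler_nat; apply: leq_trans (ltnW (ltn_expl M _)) => //.
  exact: leq_bigmax_seq.
rewrite ler_wpM2l ?mulr_ge0 ?powR_ge0//.
exact: geometric_sum_le.
Qed.

End WeakType.

(** * From a cardinality bound to an inclusion of [T1] in [lp] *)

Section Converse.
Variables (R : realType) (G : choiceType).
Variables (mul : G -> G -> G) (inv : G -> G) (one : G).
Hypothesis HG : is_group mul inv one.
Implicit Types (S : set G) (F X Y : {fset G}).
Local Notation normc := ComplexField.Normc.normc.

Lemma normc_ge0 (z : R[i]) : 0 <= normc z.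
Proof. by case: z => a b /=; exact: sqrtr_ge0. Qed.

Lemma normcD_le (z w : R[i]) : normc (z + w) <= normc z + normc w.
Proof. by rewrite -lecR rmorphD /=; exact: (@ler_normD _ R[i]). Qed.

Lemma row_sums_bounded (g : G -> G -> R) : (forall x y, 0 <= g x y) ->
  (ereal_sup (range (fun x => \esum_(y in [set: G]) (g x y)%:E)) < +oo)%E ->
  exists2 C : R, 0 < C & forall x Y, \sum_(y <- Y) g x y <= C.
Proof.
move=> g0; set s := ereal_sup _ => s_fin.
have s_ge x Y : ((\sum_(y <- Y) g x y)%:E <= s)%E.
  apply: (@le_trans _ _ (\esum_(y in [set: G]) (g x y)%:E)%E).
    apply: esum_ge; exists [set` Y] => //.
    by rewrite fsbig_finite// set_fsetK sumEFin.
  by apply: ereal_sup_ubound; exists x.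
have s0 : (0 <= s)%E by have := s_ge one fset0; rewrite big_seq_fset0.
exists (fine s + 1) => [|x Y]; first by rewrite ltr_wpDl// fine_ge0.
by rewrite ler_wpDr// -lee_fin fineK// ge0_fin_numE.
Qed.

(** Sum [f1] along rows and [f2] along columns; the pointwise bound is the case of the pair
    [(one, x)]. *)
Lemma T1_pair_sum (f : G -> R[i]) : T1 mul inv f ->
  exists C : R, [/\ 0 < C, forall x, normc (f x) <= C & forall F,
    \sum_(x <- F) \sum_(y <- F) normc (f (mul (inv x) y)) <= C * (#|` F|)%:R].
Proof.
move=> [f1 [f2 [fE [f1_fin f2_fin]]]].
have [C1 C1_gt0 HC1] := row_sums_bounded (fun x y => normc_ge0 (f1 x y)) f1_fin.
have [C2 C2_gt0 HC2] := row_sums_bounded (fun y x => normc_ge0 (f2 x y)) f2_fin.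
exists (C1 + C2); split=> [|x|F]; first exact: addr_gt0.
  have := HC1 one [fset x]%fset; have := HC2 x [fset one]%fset.
  rewrite !big_seq_fset1 => h2 h1; apply: le_trans (lerD h1 h2).
  apply: le_trans (normcD_le _ _).
  by rewrite -fE (grp_inv1 HG) (grp_mul1g HG).
rewrite mulrDl ![_ * _%:R]mulrC -!sumr_const_fset.
apply: (@le_trans _ _ (\sum_(x <- F) \sum_(y <- F) (normc (f1 x y) + normc (f2 x y)))).
  by do 2![apply: ler_sum => ? _]; rewrite fE normcD_le.
under eq_bigr do rewrite big_split /=.
rewrite big_split /= [X in _ + X <= _]exchange_big /=.
by apply: lerD; apply: ler_sum => x _.
Qed.

(** Chebyshev's inequality: each inner pair contributes at least [t] to the double sum. *)
Lemma inner_pairs_superlevel (f : G -> R[i]) (C t : R) X F :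
  \sum_(x <- F) \sum_(y <- F) normc (f (mul (inv x) y)) <= C * (#|` F|)%:R ->
  0 < t -> (forall x, x \in X -> t <= normc (f x)) ->
  inner_pairs R mul inv [set` X] F <= C / t * (#|` F|)%:R.
Proof.
move=> HC t0 Xt; rewrite mulrAC ler_pdivlMr//; apply: le_trans HC.
rewrite mulr_suml; apply: ler_sum => x _; rewrite mulr_suml; apply: ler_sum => y _.
case: asboolP => [/Xt|_]; first by rewrite mul1r.
by rewrite mul0r normc_ge0.
Qed.

(** The hypothesis concerns symmetric sets containing [S0], so [X] is enlarged by its inverses and
    by [S0]; the average degree stays of order [C / t]. *)
Lemma T1_weak_type (f : G -> R[i]) S0 (p : R) : 0 < p ->
  T1 mul inv f -> finite_set S0 -> symmetric_set inv S0 ->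
  (forall S, finite_set S -> symmetric_set inv S -> S0 `<=` S -> S !=set0 ->
    fcard R S <= max_avg_degree R mul S `^ p) ->
  exists2 K : R, 0 < K & forall X (t : R), 0 < t ->
    (forall x, x \in X -> t <= normc (f x)) -> (#|` X|)%:R <= (K / t) `^ p.
Proof.
move=> p0 /T1_pair_sum[C [C0 f_le HC]] S0fin S0sym HS.
exists ((fcard R S0 + 2) * C) => [|X t t0 Xt].
  by rewrite mulr_gt0// ltr_wpDl// fcard_ge0.
have [->|X0] := eqVneq X fset0; first by rewrite cardfs0 powR_ge0.
have [z zX] : exists z, z \in X by apply/fset0Pn.
have tC : 1 <= C / t by rewrite ler_pdivlMr// mul1r (le_trans (Xt z zX)).
pose Xi := inv @` [set` X].
have Xi_fin : finite_set Xi by exact: finite_image.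
pose S := S0 `|` [set` X] `|` Xi.
have Sfin : finite_set S by rewrite !finite_setU.
have Ssym : symmetric_set inv S.
  move=> s [[/S0sym|sX]|[x xX <-]]; [by left; left|by right; exists s|left; right].
  by rewrite (grp_invK HG).
(* [X] and its inverse contribute [C / t] each, and [S0] at most [fcard R S0], which is absorbed
   because [C / t] is at least 1. *)
have deg_le : max_avg_degree R mul S <= (fcard R S0 + 2) * C / t.
  rewrite -mulrA; apply: (max_avg_degree_le HG) => // F.
  have S0F : inner_pairs R mul inv S0 F <= fcard R S0 * (C / t) * (#|` F|)%:R.
    rewrite mulrC -sumr_const_fset; apply: ler_sum => x _.
    rewrite (sum_translate R HG)//; apply: (@le_trans _ _ (fcard R S0)).
      rewrite /fcard -[leRHS]mulr1 -sumr_const_fset; apply: ler_sum => s _.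
      by rewrite lern1 leq_b1.
    by rewrite ler_peMr// fcard_ge0.
  have XF := inner_pairs_superlevel (HC F) t0 Xt.
  have XiF : inner_pairs R mul inv Xi F <= C / t * (#|` F|)%:R.
    apply: le_trans XF; rewrite /inner_pairs exchange_big /=.
    do 2![apply: ler_sum => ? _]; rewrite ler_nat.
    case: asboolP => // -[z' z'X /(congr1 inv)].
    by rewrite (grp_invM HG) !(grp_invK HG) => <-; rewrite asboolT.
  apply: (@le_trans _ _ (inner_pairs R mul inv S0 F +
     (inner_pairs R mul inv [set` X] F + inner_pairs R mul inv Xi F))).
    rewrite /inner_pairs -!big_split /=; apply: ler_sum => x _.
    rewrite -!big_split /=; apply: ler_sum => y _; rewrite -!natrD ler_nat.
    by case: asboolP => // -[[/asboolT->|/asboolT->]|/asboolT->];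
      rewrite ?addn1 ?addn0 ?add0n ?addnS.
  lra.
apply: le_trans (_ : max_avg_degree R mul S `^ p <= _).
  apply: le_trans (HS S Sfin Ssym _ _); [|by move=> x; left; left|].
    by rewrite -fcard_fset; apply: le_fcard => // x; left; right.
  by exists z; left; right.
rewrite ge0_ler_powR ?nnegrE//.
- exact: ltW.
- apply: le_trans ler01 (max_avg_degree_ge1 R HG Sfin Ssym _).
  by exists z; left; right.
- by rewrite mulr_ge0 ?invr_ge0 ?mulr_ge0 ?addr_ge0 ?fcard_ge0// ltW.
Qed.

Lemma T1_sub_lp S0 (p q : R) : 0 < p -> p < q ->
  finite_set S0 -> symmetric_set inv S0 ->
  (forall S, finite_set S -> symmetric_set inv S -> S0 `<=` S -> S !=set0 ->
    fcard R S <= max_avg_degree R mul S `^ p) ->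
  T1 mul inv `<=` @lp R G q.
Proof.
move=> p0 pq S0fin S0sym HS f fT1.
have [K K0 HK] := T1_weak_type p0 fT1 S0fin S0sym HS.
by apply: weak_type_esum K0 p0 pq _ HK => x; exact: normc_ge0.
Qed.

End Converse.

(** * Comparison of the two exponents *)

Section Exponents.
Variables (R : realType) (G : choiceType).
Variables (mul : G -> G -> G) (inv : G -> G) (one : G).
Hypothesis HG : is_group mul inv one.
Implicit Types S : set G.

Let deg S := max_avg_degree R mul S.

Lemma eta_ratioE S : finite_set S -> symmetric_set inv S ->
  1 < fcard R S -> eta_ratio R mul S = ln (deg S) / ln (fcard R S) - 1.
Proof.
move=> Sfin Ssym S1; have S0 : 0 < fcard R S by exact: lt_trans S1.
have d1 : 1 <= deg S.
  by apply: (max_avg_degree_ge1 R HG) => //; exact: fcard_gt0_nonempty S0.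
have -> : ln (deg S) / ln (fcard R S) - 1 =
    (ln (deg S) - ln (fcard R S)) / ln (fcard R S).
  by rewrite mulrBl divff// gt_eqF// ln_gt0.
rewrite /eta_ratio -ln_div ?posrE//; last exact: lt_le_trans d1.
by rewrite /e_const /deg /max_avg_degree mulrBl divff// gt_eqF.
Qed.

Lemma eta_ratio_bounds S : fin_sym inv S -> -1 <= eta_ratio R mul S <= 0.
Proof.
move=> [Sfin Ssym]; have [S1|S1] := ltP 1 (fcard R S).
  rewrite eta_ratioE//; have lS : 0 < ln (fcard R S) by rewrite ln_gt0.
  have S_gt0 : 0 < fcard R S by exact: lt_trans S1.
  have d1 := max_avg_degree_ge1 R HG Sfin Ssym (fcard_gt0_nonempty S_gt0).
  apply/andP; split; first by rewrite lerBrDr addNr divr_ge0 ?ln_ge0// ltW.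
  rewrite lerBlDr add0r ler_pdivrMr// mul1r ler_ln ?posrE//.
    exact: max_avg_degree_le_card.
  exact: lt_le_trans d1.
(* For at most one element the logarithm is 0, with [ln 0 = 0] by convention, and division by 0
   makes the ratio 0. *)
by rewrite /eta_ratio (_ : ln (fcard R S) = 0) ?invr0 ?mulr0 ?lexx ?lerN10//;
   move: S1; rewrite /fcard lern1; case: (#|` _|)%N => [|[]]// _;
   rewrite ?ln1// ln0.
Qed.

Let liminf_ratio : \bar R := ereal_sup [set ereal_inf [set (eta_ratio R mul S')%:E |
                                     S' in [set S' | fin_sym inv S' /\ S `<=` S']]
                    | S in fin_sym inv].

Lemma fin_sym0 : fin_sym inv set0.
Proof. by split; [exact: finite_set0|]. Qed.

Lemma fin_symU S : finite_set S -> fin_sym inv (S `|` inv @` S).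
Proof.
move=> Sfin; split; first by rewrite finite_setU; split=> //; exact: finite_image.
by move=> s [Ss|[x Sx <-]]; [right; exists s|left; rewrite (grp_invK HG)].
Qed.

Lemma liminf_ratio_ge : (-1%:E <= liminf_ratio)%E.
Proof.
apply: (@le_trans _ _ (ereal_inf [set (eta_ratio R mul S')%:E |
    S' in [set S' | fin_sym inv S' /\ set0 `<=` S']])); last first.
  by apply: ereal_sup_ubound; exists set0 => //; exact: fin_sym0.
apply: le_ereal_inf_tmp => _ [S [HS _] <-]; rewrite lee_fin.
by have /andP[] := eta_ratio_bounds HS.
Qed.

Lemma liminf_ratio_le0 : (liminf_ratio <= 0)%E.
Proof.
apply: ge_ereal_sup => _ [S HS <-].
apply: (@le_trans _ _ (eta_ratio R mul S)%:E).
  by apply: ereal_inf_lbound; exists S => //; split.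
by rewrite lee_fin; have /andP[] := eta_ratio_bounds HS.
Qed.

Lemma liminf_ratio_lower (p : R) : infinite_set [set: G] -> 0 < p ->
  T1 mul inv `<=` @lp R G p -> ((p^-1 - 1)%:E <= liminf_ratio)%E.
Proof.
move=> Ginf p0 T1p; have [K K0 HK] := T1_lp_card_bound HG p0 T1p.
apply/lee_subgt0Pr => eps eps0.
(* Once [ln (fcard R S)] reaches [c], the error is at most [eps]; the summand 1 forces
   [fcard R S > 1]. *)
pose c := `|ln K| / (p * eps) + 1.
have [B _ HB] := infinite_set_fset (Num.truncn (expR c)).+1 Ginf.
pose S0 := [set` B] `|` inv @` [set` B].
apply: (@le_trans _ _ (ereal_inf [set (eta_ratio R mul S')%:E |
    S' in [set S' | fin_sym inv S' /\ S0 `<=` S']])); last first.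
  by apply: ereal_sup_ubound; exists S0 => //; exact: fin_symU.
apply: le_ereal_inf_tmp => _ [S [[Sfin Ssym] S0S] <-]; rewrite -EFinB lee_fin.
have Sc : expR c <= fcard R S.
  apply: le_trans (ltW (truncnS_gt _)) _.
  apply: (@le_trans _ _ (fcard R [set` B])); first by rewrite fcard_fset ler_nat.
  by apply: le_fcard => // x Bx; apply: S0S; left.
have c1 : 1 <= c by rewrite lerDr divr_ge0// mulr_ge0// ltW.
have S1 : 1 < fcard R S.
  by apply: lt_le_trans Sc; rewrite expR_gt1; exact: lt_le_trans c1.
have S_gt0 : 0 < fcard R S by exact: lt_trans S1.
have S0' := fcard_gt0_nonempty S_gt0.
have d1 := max_avg_degree_ge1 R HG Sfin Ssym S0'.
have d0 : 0 < deg S by exact: lt_le_trans d1.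
have lS : c <= ln (fcard R S) by rewrite -[c]expRK ler_ln ?posrE ?expR_gt0.
have lS0 : 0 < ln (fcard R S) by apply: lt_le_trans lS; exact: lt_le_trans c1.
have := HK S Sfin Ssym S0'.
rewrite -ler_ln ?posrE ?mulr_gt0 ?powR_gt0// lnM ?posrE ?powR_gt0// ln_powR => HSK.
rewrite eta_ratioE// lerBlDr addrAC lerB// -lerBlDr ler_pdivlMr//.
have : `|ln K| <= p * eps * ln (fcard R S).
  rewrite mulrC -ler_pdivrMr ?mulr_gt0//; apply: le_trans lS.
  by rewrite lerDl.
have := ler_norm (ln K) => hK1 hK2.
rewrite -(ler_pM2l p0) mulrA mulrBr divff ?gt_eqF//.
move: HSK; rewrite -/(deg S); lra.
Qed.

Lemma liminf_ratio_upper (p q : R) : 0 < p -> p < q ->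
  ((p^-1 - 1)%:E < liminf_ratio)%E ->
  T1 mul inv `<=` @lp R G q.
Proof.
move=> p0 pq /ereal_sup_gt[_ [S0 [S0fin S0sym] <-]] HS0.
apply: (T1_sub_lp HG p0 pq S0fin S0sym) => S Sfin Ssym S0S Sn0.
have d1 := max_avg_degree_ge1 R HG Sfin Ssym Sn0.
have d0 : 0 < deg S by exact: lt_le_trans d1.
have [S1|S1] := ltP 1 (fcard R S); last first.
  apply: le_trans S1 _; rewrite -(powRr0 (deg S)); apply: ler_powR => //.
  exact: ltW.
have S_gt0 : 0 < fcard R S by exact: lt_trans S1.
have : p^-1 - 1 < eta_ratio R mul S.
  rewrite -lte_fin; apply: lt_le_trans HS0 _.
  by apply: ereal_inf_lbound; exists S => //; split.
rewrite eta_ratioE// ltrD2r ltr_pdivlMr ?ln_gt0// ltr_pdivrMl// => h.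
rewrite -ler_ln ?posrE ?powR_gt0// ln_powR; exact: ltW.
Qed.

(** All functions on a finite group are in every [lp]. With [einv 0 = +oo] this matches the
    convention that [eta_exp] is [-oo]. *)
Lemma Lit_exp_finite : finite_set [set: G] -> Lit_exp R mul inv = 0%E.
Proof.
move=> Gfin; apply/eqP; rewrite eq_le; apply/andP; split; last first.
  by apply: le_ereal_inf_tmp => _ [p [p0 _] <-]; rewrite lee_fin ltW.
apply/lee_addgt0Pr => eps eps0; rewrite add0e.
apply: ereal_inf_lbound; exists eps => //; split=> // f _.
rewrite /lp /= esum_fset//; last by move=> x _; rewrite lee_fin powR_ge0.
by rewrite fsbig_finite// sumEFin ltry.
Qed.

Lemma einv_Lit_exp : infinite_set [set: G] ->
  einv (Lit_exp R mul inv) = (liminf_ratio + 1)%E.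
Proof.
move=> Ginf; have := liminf_ratio_ge; have := liminf_ratio_le0.
have := @liminf_ratio_upper; have := fun p => @liminf_ratio_lower p Ginf.
case: liminf_ratio => [e| |] Elow Eup; rewrite ?leye_eq ?leeNy_eq// !lee_fin => _ e1.
have [e1E|e1N] := eqVneq (e + 1) 0.
  (* When the lower limit is -1, an admissible [p] would satisfy [p^-1 <= 0]; so none exists and
     [Lit_exp] is [+oo]. *)
  rewrite -EFinD e1E /Lit_exp (_ : [set _ | _ in _] = set0) ?ereal_inf0//.
  apply/seteqP; split=> // _ [p [p0 T1p] _] /=.
  have := Elow p p0 T1p; rewrite lee_fin => h.
  have : 0 < p^-1 by rewrite invr_gt0.
  lra.
have c0 : 0 < e + 1 by rewrite lt_neqAle eq_sym e1N; lra.
suff -> : Lit_exp R mul inv = (e + 1)^-1%:E.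
  by rewrite /einv gt_eqF ?invr_gt0// invrK EFinD.
apply/eqP; rewrite eq_le; apply/andP; split; last first.
  apply: le_ereal_inf_tmp => _ [p [p0 T1p] <-]; rewrite lee_fin.
  have := Elow p p0 T1p; rewrite lee_fin => h.
  by rewrite invf_ple ?posrE//; lra.
apply/lee_addgt0Pr => eps eps0.
rewrite -EFinD; apply: ereal_inf_lbound.
exists ((e + 1)^-1 + eps) => //; split; first by rewrite addr_gt0// invr_gt0.
(* Halving [eps] leaves room for both strict inequalities of [liminf_ratio_upper]. *)
apply: (Eup ((e + 1)^-1 + eps / 2)).
- by rewrite addr_gt0 ?invr_gt0// divr_gt0.
- by rewrite ltrD2l; lra.
- rewrite lte_fin ltrBlDr invf_plt ?posrE//; first by rewrite ltrDl divr_gt0.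
  by rewrite addr_gt0 ?invr_gt0// divr_gt0.
Qed.

Lemma eta_exp_Lit_exp : eta_exp R mul inv = (1 - einv (Lit_exp R mul inv))%E.
Proof.
rewrite /eta_exp; case: asboolP => [Gfin|Ginf].
  by rewrite Lit_exp_finite// /einv /= eqxx.
rewrite einv_Lit_exp// -/liminf_ratio; have := liminf_ratio_ge; have := liminf_ratio_le0.
case: liminf_ratio => [e| |]; rewrite ?leye_eq ?leeNy_eq// => _ _.
have e_eq : - e = 1 - (e + 1) by lra.
by rewrite -EFinN e_eq EFinB EFinD.
Qed.

End Exponents.

Theorem theorem1p4 (R : realType) (G : choiceType)
  (mul : G -> G -> G) (inv : G -> G) (one : G)
  (HG : is_group mul inv one) :
  @eta_exp R G mul inv = (1 - einv (@Lit_exp R G mul inv))%E.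
Proof. exact: eta_exp_Lit_exp HG. Qed.
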